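(* Let $K\in\mathcal{K}_0^n$. Then $K\in\mathcal{R}^n$ if and only if $K^{\clubsuit}$ is convex.
   Context: A convex body in $\mathbb{R}^n$ is a closed convex set $K\subseteq\mathbb{R}^n$ with $0\in K$ (not assumed compact, nor with non-empty interior); $\mathcal{K}_0^n$ is the set of all convex bodies. The support function of $K$ is $h_K:S^{n-1}\to[0,\infty]$, $h_K(\theta)=\sup_{x\in K}\langle x,\theta\rangle$. A star set is a non-empty $A\subseteq\mathbb{R}^n$ such that $x\in A$ and $0\le\lambda\le1$ imply $\lambda x\in A$; its radial function is $r_A:S^{n-1}\to[0,\infty]$, $r_A(\theta)=\sup\{\lambda\ge0:\lambda\theta\in A\}$. A star body is a star set $A$ with $r_A(\theta)\theta\in A$ for all $\theta\in S^{n-1}$ with $r_A(\theta)<\infty$; it is uniquely determined by $r_A$. For $K\in\mathcal{K}_0^n$, the flower $K^{\clubsuit}$ of $K$ is the star body with radial function $r_{K^{\clubsuit}}=h_K$. For $g:S^{n-1}\to[0,\infty]$, $A[g]=\{x\in\mathbb{R}^n:\langle x,\theta\rangle\le g(\theta)\text{ for all }\theta\in S^{n-1}\}$. The reciprocal body of $K\in\mathcal{K}_0^n$ is $K'=A[1/h_K]\in\mathcal{K}_0^n$, with $1/0=\infty$, $1/\infty=0$. $\mathcal{R}^n=\{K':K\in\mathcal{K}_0^n\}$ is the class of reciprocal bodies. *)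

(* Defs.v *)
From HB Require Import structures.
From mathcomp Require Import all_boot all_order all_algebra.
From mathcomp Require Import all_classical all_reals all_analysis.

Set Implicit Arguments.
Unset Strict Implicit.
Unset Printing Implicit Defensive.

Import Order.TTheory GRing.Theory Num.Theory.
Import numFieldNormedType.Exports.

Local Open Scope classical_set_scope.
Local Open Scope ring_scope.

(* The library norm on ['rV[R]_n] is the sup norm: it induces the Euclidean
   topology, but the inner product and the unit sphere need definitions. *)
Definition dotp (R : realType) (n : nat) (x y : 'rV[R]_n) : R :=
  \sum_(i < n) x 0 i * y 0 i.

Definition unit_sphere (R : realType) (n : nat) : set 'rV[R]_n :=
  [set u | dotp u u = 1].
Arguments unit_sphere : clear implicits.

Definition convex_body (R : realType) (n : nat) : set (set 'rV[R]_n) :=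
  [set K : set 'rV[R]_n | [/\ closed K, convex_set K & K 0]].
Arguments convex_body : clear implicits.

(* Functions on the unit sphere are represented by functions on the whole of
   ['rV[R]_n] whose values are only ever used on [unit_sphere R n]. *)
Definition support_fun (R : realType) (n : nat) (K : set 'rV[R]_n)
    (u : 'rV[R]_n) : \bar R :=
  ereal_sup [set (dotp x u)%:E | x in K].

Definition star_set (R : realType) (n : nat) (A : set 'rV[R]_n) : Prop :=
  A !=set0 /\ forall x l, A x -> 0 <= l <= 1 -> A (l *: x).

Definition radial_fun (R : realType) (n : nat) (A : set 'rV[R]_n)
    (u : 'rV[R]_n) : \bar R :=
  ereal_sup [set l%:E | l in [set l : R | 0 <= l /\ A (l *: u)]].

Definition star_body (R : realType) (n : nat) (A : set 'rV[R]_n) : Prop :=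
  star_set A /\
  forall u, unit_sphere R n u -> (radial_fun A u < +oo)%E ->
    A (fine (radial_fun A u) *: u).

(* [get] picks the star body with radial function [support_fun K]; it exists
   and is unique when [0] is in [K], see [flowerP]. *)
Definition flower (R : realType) (n : nat) (K : set 'rV[R]_n) :
    set 'rV[R]_n :=
  get [set A | star_body A /\
               forall u, unit_sphere R n u -> radial_fun A u = support_fun K u].

Definition wulff (R : realType) (n : nat) (g : 'rV[R]_n -> \bar R) :
    set 'rV[R]_n :=
  [set x | forall u, unit_sphere R n u -> ((dotp x u)%:E <= g u)%E].

(* The library inverse on [\bar R] satisfies [0^-1 = +oo] and [+oo^-1 = 0]. *)
Definition reciprocal (R : realType) (n : nat) (K : set 'rV[R]_n) :
    set 'rV[R]_n :=
  wulff (fun u => (support_fun K u)^-1%E).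

Definition reciprocal_bodies (R : realType) (n : nat) : set (set 'rV[R]_n) :=
  [set reciprocal K | K in convex_body R n].
Arguments reciprocal_bodies : clear implicits.

Lemma dotpC (R : realType) (n : nat) (x y : 'rV[R]_n) : dotp x y = dotp y x.
Proof. by apply: eq_bigr => i _; rewrite mulrC. Qed.

Lemma dotpZl (R : realType) (n : nat) (a : R) (x y : 'rV[R]_n) :
  dotp (a *: x) y = a * dotp x y.
Proof. by rewrite /dotp mulr_sumr; apply: eq_bigr => i _; rewrite mxE mulrA. Qed.

Lemma dotpDl (R : realType) (n : nat) (x y z : 'rV[R]_n) :
  dotp (x + y) z = dotp x z + dotp y z.
Proof.
by rewrite /dotp -big_split; apply: eq_bigr => i _; rewrite mxE mulrDl.
Qed.

Lemma dotp0l (R : realType) (n : nat) (x : 'rV[R]_n) : dotp 0 x = 0.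
Proof. by rewrite -(scale0r x) dotpZl mul0r. Qed.

Lemma dotp_gt0 (R : realType) (n : nat) (x : 'rV[R]_n) :
  x != 0 -> 0 < dotp x x.
Proof.
move=> x0; rewrite lt_neqAle sumr_ge0 ?andbT; last first.
  by move=> i _; rewrite -expr2 sqr_ge0.
apply: contra x0 => /eqP/esym d0; apply/eqP/rowP => i; rewrite mxE.
have /psumr_eq0P : forall i, true -> 0 <= x 0 i * x 0 i.
  by move=> j _; rewrite -expr2 sqr_ge0.
by move=> /(_ d0) /(_ i isT) /eqP; rewrite mulf_eq0 orbb => /eqP.
Qed.

Lemma polar_decomp (R : realType) (n : nat) (x : 'rV[R]_n) : x != 0 ->
  exists t u, [/\ 0 < t, unit_sphere R n u & x = t *: u].
Proof.
move=> /dotp_gt0 x0.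
exists (Num.sqrt (dotp x x)), ((Num.sqrt (dotp x x))^-1 *: x).
have s0 : 0 < Num.sqrt (dotp x x) by rewrite sqrtr_gt0.
split=> //; last by rewrite scalerA divff ?scale1r// gt_eqF.
rewrite /unit_sphere/= dotpZl dotpC dotpZl mulrA -invfM -expr2 sqr_sqrtr ?ltW//.
by rewrite mulVf// gt_eqF.
Qed.

Lemma polar_unique (R : realType) (n : nat) (s t : R) (u v : 'rV[R]_n) :
  unit_sphere R n u -> unit_sphere R n v -> 0 <= s -> 0 < t -> s *: u = t *: v ->
  s = t /\ u = v.
Proof.
rewrite /unit_sphere/= => uu vv s0 t0 e.
have st : s = t.
  have : dotp (s *: u) (s *: u) = dotp (t *: v) (t *: v) by rewrite e.
  rewrite !(dotpZl, dotpC _ (_ *: _)) uu vv !mulr1 -!expr2 => /eqP.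
  by rewrite eqrXn2 ?(ltW t0)// => /eqP.
split=> //; move: e; rewrite st => /(congr1 (fun z => t^-1 *: z)).
by rewrite !scalerA mulVf ?gt_eqF// !scale1r.
Qed.

Lemma support_fun_ge0 (R : realType) (n : nat) (K : set 'rV[R]_n) u :
  K 0 -> (0 <= support_fun K u)%E.
Proof. by move=> K0; apply: ereal_sup_ubound; exists 0; rewrite ?dotp0l. Qed.

Lemma star_set0 (R : realType) (n : nat) (A : set 'rV[R]_n) :
  star_set A -> A 0.
Proof.
by move=> [[x Ax] sA]; rewrite -(scale0r x); apply: sA => //; rewrite lexx ler01.
Qed.

Lemma radial_fun_ge0 (R : realType) (n : nat) (A : set 'rV[R]_n) u :
  star_set A -> (0 <= radial_fun A u)%E.
Proof.
move=> /star_set0 A0; apply: ereal_sup_ubound; exists 0 => //=.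
by rewrite scale0r.
Qed.

Lemma star_bodyE (R : realType) (n : nat) (A : set 'rV[R]_n) t u :
  star_body A -> unit_sphere R n u -> 0 <= t ->
  A (t *: u) <-> (t%:E <= radial_fun A u)%E.
Proof.
move=> [sA bA] uS t0; split=> [Atu|]; first by apply: ereal_sup_ubound; exists t.
have down s : t <= s -> A (s *: u) -> A (t *: u).
  rewrite le_eqVlt => /predU1P[->//|ts] Asu.
  have s0 : 0 < s by exact: le_lt_trans ts.
  rewrite (_ : t *: u = (t / s) *: (s *: u)); last first.
    by rewrite scalerA divfK// gt_eqF.
  by apply: sA.2 => //; rewrite divr_ge0 ?(ltW s0)//= ler_pdivrMr// mul1r ltW.
have r0 := radial_fun_ge0 u sA.
case E : (radial_fun A u) => [r| |].
- have := bA _ uS; rewrite E ltry => /(_ isT) /= Aru.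
  by rewrite lee_fin => /down; exact.
- move=> _; have : (t%:E < radial_fun A u)%E by rewrite E ltry.
  move=> /ereal_sup_gt[_ /= [s [_ Asu] <-]]; rewrite lte_fin => /ltW /down; exact.
- by rewrite E in r0.
Qed.

Lemma star_body_inj (R : realType) (n : nat) (A B : set 'rV[R]_n) :
  star_body A -> star_body B ->
  (forall u, unit_sphere R n u -> radial_fun A u = radial_fun B u) -> A = B.
Proof.
suff sub (C D : set 'rV[R]_n) : star_body C -> star_body D ->
    (forall u, unit_sphere R n u -> radial_fun C u = radial_fun D u) ->
    C `<=` D.
  by move=> sA sB AB; apply/seteqP; split; apply: sub => // u uS; rewrite AB.
move=> sC sD CD x; have [->|] := eqVneq x 0.
  by move=> _; exact: star_set0 sD.1.
move=> /polar_decomp[t [u [t0 uS ->]]] /(star_bodyE sC uS (ltW t0)).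
by rewrite CD// => /(star_bodyE sD uS (ltW t0)).
Qed.

Lemma star_body_exists (R : realType) (n : nat) (r : 'rV[R]_n -> \bar R) :
  (forall u, unit_sphere R n u -> (0 <= r u)%E) ->
  exists A, star_body A /\ forall u, unit_sphere R n u -> radial_fun A u = r u.
Proof.
move=> r0; pose A : set 'rV[R]_n :=
  [set x | forall t u, 0 < t -> unit_sphere R n u -> x = t *: u ->
                       (t%:E <= r u)%E].
have A0 : A 0.
  move=> t u t0 /= uS /esym/eqP; rewrite scaler_eq0 gt_eqF//= => /eqP u0.
  by move: uS; rewrite /unit_sphere/= u0 dotp0l => /esym/eqP; rewrite oner_eq0.
have AE t u : unit_sphere R n u -> 0 <= t -> A (t *: u) <-> (t%:E <= r u)%E.
  move=> uS; rewrite le_eqVlt => /predU1P[<-|t0].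
    by rewrite scale0r; split => // _; exact: r0.
  split=> [/(_ t u t0 uS erefl)//|tr s v s0 vS e].
  by have [<- <-] := polar_unique uS vS (ltW t0) s0 e.
have sA : star_set A.
  split; first by exists 0.
  move=> x l Ax /andP[l0 l1].
  have [->|/polar_decomp[t [u [t0 uS xE]]]] := eqVneq x 0; first by rewrite scaler0.
  move: Ax; rewrite xE scalerA => /(AE _ _ uS (ltW t0)) tr.
  apply/(AE _ _ uS); first by rewrite mulr_ge0// ltW.
  by apply: le_trans tr; rewrite lee_fin ler_piMl// ltW.
have rA u : unit_sphere R n u -> radial_fun A u = r u.
  move=> uS; apply/eqP; rewrite eq_le; apply/andP; split.
    by apply: ge_ereal_sup => _ [l [l0 Al] <-]; apply/AE.
  have := r0 u uS; case E : (r u) => [s| |]// s0.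
    by apply: ereal_sup_ubound; exists s => //=; split=> //; apply/AE; rewrite ?E.
  rewrite leye_eq; apply/eqP/eqyP => s sgt0.
  apply: ereal_sup_ubound; exists s => //=; split; first exact: ltW.
  by apply/AE => //; [exact: ltW|rewrite E leey].
exists A; split=> //; split=> // u uS.
rewrite rA//; have := r0 u uS; case E : (r u) => [s| |]//= s0 _.
by apply/AE; rewrite ?E.
Qed.

Lemma flowerP (R : realType) (n : nat) (K : set 'rV[R]_n) : K 0 ->
  forall A, A = flower K <->
    star_body A /\ forall u, unit_sphere R n u -> radial_fun A u = support_fun K u.
Proof.
move=> K0 A.
have [B [sB rB]] : exists B, star_body B /\
    forall u, unit_sphere R n u -> radial_fun B u = support_fun K u.
  by apply: star_body_exists => u _; exact: support_fun_ge0.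
have uniq C : star_body C /\
    (forall u, unit_sphere R n u -> radial_fun C u = support_fun K u) -> C = B.
  by move=> [sC rC]; apply: star_body_inj => // u uS; rewrite rC// rB.
have -> : flower K = B by exact: get_unique.
by split=> [->|/uniq].
Qed.

Lemma reciprocal_convex_body (R : realType) (n : nat) (K : set 'rV[R]_n) :
  convex_body R n K -> convex_body R n (reciprocal K).
Proof.
move=> [_ _ K0].
have g0 u : (0 <= (support_fun K u)^-1)%E.
  by rewrite inve_ge0; exact: support_fun_ge0.
split; last by move=> u _; rewrite dotp0l.
- have -> : reciprocal K = \bigcap_(u in unit_sphere R n)
      ((fun x => (dotp x u)) @^-1` [set s : R | (s%:E <= (support_fun K u)^-1)%E]).
    by [].
  apply: closed_bigI => u _.
  apply: preimage_closed => [x _|].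
    apply: continuous_big => [|i _ y].
      exact: add_continuous.
    apply: (@cvgM _ _ (nbhs y)); last exact: cvg_cst.
    exact: (@coord_continuous _ _ _ 0 i y).
  case: (support_fun K u)^-1%E (g0 u) => [s| |]// _.
  rewrite (_ : [set _ | _] = setT); first exact: closedT.
  by apply/seteqP; split=> t //= _; rewrite leey.
- move=> x y l /set_mem Kx /set_mem Ky; apply/mem_set => u uS.
  have := Kx u uS; have := Ky u uS.
  case: (support_fun K u)^-1%E (g0 u) => [s| |]// _; last by rewrite !leey.
  rewrite !lee_fin => xs ys; rewrite dotpDl !dotpZl.
  rewrite (_ : s = l%:num * s + (1 - l%:num) * s); last first.
    by rewrite -mulrDl subrKC mul1r.
  by apply: lerD; apply: ler_wpM2l; rewrite ?subr_ge0.
Qed.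

(* Main.v *)
Require Import Defs.
From mathcomp Require Import all_boot all_order all_algebra.
From mathcomp Require Import all_classical all_reals all_analysis.
From mathcomp Require Import ring lra.

Set Implicit Arguments.
Unset Strict Implicit.
Unset Printing Implicit Defensive.

Import Order.TTheory GRing.Theory Num.Theory.
Import numFieldNormedType.Exports.

Local Open Scope classical_set_scope.
Local Open Scope ring_scope.

(** Two descriptions reduce the theorem to the inner product. A point [y] is in
    the reciprocal body of [K] iff [<y, x> <z, x> <= |x|^2] for all [z] in [K]
    and all [x] ([reciprocalP]): up to scaling by [u], this is
    [<y, u> <= 1 / h_K(u)]. The relation is symmetric, so reciprocity is a Galois
    connection, and [K] is a reciprocal body iff it equals its double reciprocal.
    Up to radial closure, the flower of [K] is the set of the [x] with
    [|x|^2 <= <x, y>] for some [y] in [K], which is the union of the balls with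
    diameter [[0, y]] ([in_flowerP]).

    Flowers of reciprocal bodies are convex. Maximizing over [x] turns the
    relation into [<y, z> + |y||z| <= 2] ([reciprocal_rel_paraboloid]): for fixed
    [z] this is a solid paraboloid in [y] with focus the origin. Given points of
    the balls of [y1] and [y2], a convex combination [m] of them satisfies
    [2m = Y + e], where [Y] is the same combination of [y1] and [y2] and [|e|] is
    at most the combination [rho] of their norms. All the paraboloid inequalities
    hold with [Y] and [rho] in place of [y] and [|y|]. If [|e| <= |Y|], then [m]
    is in the ball of [Y] itself. Otherwise, moving from [Y] along [e] by a
    fraction [s] until the norm equals [(1 - s)|e|] keeps these inequalities,
    because [<e, z> <= |e||z|] and [|e| <= rho], and puts [m] on the sphere with
    diameter [[0, Y + s e]] ([refocus]).

    Conversely, let the flower be convex and [y] not in [K]. Separation of [y]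
    from [K] gives a point [p] outside the flower with [|p|^2 < <y, p>]
    ([flower_separation_point]). A half-space [<., z> <= 1] containing the flower
    and missing [p] gives [z] in the reciprocal of [K], with
    [<y, p> <z, p> > |p|^2], so [y] is not in the double reciprocal
    ([flower_separation]). Since the flower need not be closed, [p] is first
    pushed away from an interior point of the flower, out of its closure. *)


(** * The Euclidean norm *)

Lemma dotpDr (R : realType) (n : nat) (x y z : 'rV[R]_n) :
  dotp x (y + z) = dotp x y + dotp x z.
Proof. by rewrite dotpC dotpDl !(dotpC x). Qed.

Lemma dotpZr (R : realType) (n : nat) (a : R) (x y : 'rV[R]_n) :
  dotp x (a *: y) = a * dotp x y.
Proof. by rewrite dotpC dotpZl dotpC. Qed.

Lemma dotpNl (R : realType) (n : nat) (x y : 'rV[R]_n) :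
  dotp (- x) y = - dotp x y.
Proof. by rewrite -scaleN1r dotpZl mulN1r. Qed.

Lemma dotpNr (R : realType) (n : nat) (x y : 'rV[R]_n) :
  dotp x (- y) = - dotp x y.
Proof. by rewrite dotpC dotpNl dotpC. Qed.

Definition dotp_lin := (dotpDl, dotpDr, dotpNl, dotpNr, dotpZl, dotpZr).

Lemma dotp_ge0 (R : realType) (n : nat) (x : 'rV[R]_n) : 0 <= dotp x x.
Proof. by have [->|/dotp_gt0/ltW//] := eqVneq x 0; rewrite dotp0l. Qed.

Definition enorm (R : realType) (n : nat) (x : 'rV[R]_n) : R :=
  Num.sqrt (dotp x x).

Lemma enorm_ge0 (R : realType) (n : nat) (x : 'rV[R]_n) : 0 <= enorm x.
Proof. exact: sqrtr_ge0. Qed.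

Lemma sqr_enorm (R : realType) (n : nat) (x : 'rV[R]_n) :
  enorm x ^+ 2 = dotp x x.
Proof. by rewrite sqr_sqrtr// dotp_ge0. Qed.

Lemma enorm_gt0 (R : realType) (n : nat) (x : 'rV[R]_n) :
  x != 0 -> 0 < enorm x.
Proof. by move=> /dotp_gt0; rewrite sqrtr_gt0. Qed.

Lemma enorm_le (R : realType) (n : nat) (x : 'rV[R]_n) (a : R) :
  0 <= a -> (enorm x <= a) = (dotp x x <= a ^+ 2).
Proof.
by move=> a0; rewrite -sqr_enorm -ler_sqr ?nnegrE// enorm_ge0.
Qed.

Lemma enormZ (R : realType) (n : nat) (a : R) (x : 'rV[R]_n) :
  0 <= a -> enorm (a *: x) = a * enorm x.
Proof.
move=> a0; rewrite /enorm !dotp_lin mulrA -expr2 sqrtrM ?sqr_ge0//.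
by rewrite sqrtr_sqr ger0_norm.
Qed.

(** The vector [|y|^2 x - <x, y> y] has a nonnegative square, which is [|y|^2]
    times the difference of the two sides. *)
Lemma cauchy_schwarz (R : realType) (n : nat) (x y : 'rV[R]_n) :
  dotp x y ^+ 2 <= dotp x x * dotp y y.
Proof.
have [->|y0] := eqVneq y 0.
  by rewrite dotpC !dotp0l expr2 !mulr0.
have yy := dotp_gt0 y0.
have := dotp_ge0 (dotp y y *: x - dotp x y *: y).
rewrite !dotp_lin (dotpC y x) => h.
have {h} : 0 <= dotp y y * (dotp x x * dotp y y - dotp x y ^+ 2).
  by apply: le_trans h _; rewrite le_eqVlt; apply/orP; left; apply/eqP; ring.
by rewrite pmulr_rge0// subr_ge0.
Qed.

Lemma dotp_le_enorm (R : realType) (n : nat) (x y : 'rV[R]_n) :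
  dotp x y <= enorm x * enorm y.
Proof.
apply: le_trans (ler_norm _) _.
rewrite -ler_sqr ?nnegrE ?mulr_ge0 ?enorm_ge0//.
by rewrite real_normK ?num_real// exprMn !sqr_enorm cauchy_schwarz.
Qed.

Lemma ler_enormD (R : realType) (n : nat) (x y : 'rV[R]_n) :
  enorm (x + y) <= enorm x + enorm y.
Proof.
rewrite enorm_le ?addr_ge0 ?enorm_ge0// !dotp_lin (dotpC y x) -!sqr_enorm.
by have := dotp_le_enorm x y; nra.
Qed.

(** * Reciprocity *)

(** Quantifying over all [x] instead of unit vectors avoids both normalization
    and the sign condition under which [1 / h_K] constrains [y]: replacing [x] by
    [- x] changes both signs. *)
Definition reciprocal_rel (R : realType) (n : nat) (y z : 'rV[R]_n) : Prop :=
  forall x, dotp y x * dotp z x <= dotp x x.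

Lemma reciprocal_relC (R : realType) (n : nat) (y z : 'rV[R]_n) :
  reciprocal_rel y z -> reciprocal_rel z y.
Proof. by move=> yz x; rewrite mulrC. Qed.

(** The product [<y, x> <z, x>] is largest, for given [|x|], along the bisector
    [|z| y + |y| z] of [y] and [z]. *)
Lemma reciprocal_rel_paraboloid (R : realType) (n : nat) (y z : 'rV[R]_n) :
  reciprocal_rel y z <-> dotp y z + enorm y * enorm z <= 2.
Proof.
set S := dotp y z + _.
have yn0 := enorm_ge0 y; have zn0 := enorm_ge0 z.
have yn2 := sqr_enorm y; have zn2 := sqr_enorm z.
split=> [yz|S2 x].
  have [S0|S0] := leP S 0; first by apply: le_trans S0 _.
  have [yz0|] := leP (enorm y * enorm z) 0.
    have := dotp_le_enorm y z; rewrite /S; lra.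
  move=> yz0.
  have := yz (enorm z *: y + enorm y *: z).
  rewrite !dotp_lin (dotpC z y) -yn2 -zn2 => h.
  have {h} : enorm y * enorm z * S * S <= enorm y * enorm z * S * 2.
    by apply: le_trans (le_trans h _); rewrite le_eqVlt; apply/orP; left;
      apply/eqP; rewrite /S; ring.
  by rewrite ler_pM2l// mulr_gt0.
(* After scaling to equal norms, [4 <y, x> <z, x>] is the difference of the
   squares of [<y + z, x>] and [<y - z, x>]. *)
have [->|y0] := eqVneq y 0; first by rewrite dotp0l mul0r dotp_ge0.
have [->|z0] := eqVneq z 0; first by rewrite dotp0l mulr0 dotp_ge0.
have := enorm_gt0 z0; have := enorm_gt0 y0 => ye ze.
have := cauchy_schwarz (enorm z *: y + enorm y *: z) x.
have := sqr_ge0 (dotp (enorm z *: y - enorm y *: z) x).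
rewrite !dotp_lin (dotpC z y) -yn2 -zn2 => h1 h2.
have {h1 h2} : enorm y * enorm z * (dotp y x * dotp z x * 2) <=
    enorm y * enorm z * (S * dotp x x) by rewrite /S; lra.
rewrite ler_pM2l ?mulr_gt0// => h.
have := dotp_ge0 x; nra.
Qed.

(** Inversion reverses the order on [[0, +oo]], so for [<y, u> > 0] the condition
    [<y, u> <= 1 / h_K(u)] bounds every [<z, u>] with [z] in [K] by [1 / <y, u>],
    even when [h_K(u)] is [0] or [+oo]. *)
Lemma reciprocalP (R : realType) (n : nat) (K : set 'rV[R]_n) (y : 'rV[R]_n) :
  K 0 -> reciprocal K y <-> forall z, K z -> reciprocal_rel y z.
Proof.
move=> K0; split=> [yK z Kz x|yK u uS].
- have [->|] := eqVneq x 0; first by rewrite dotpC dotp0l mul0r dotp0l.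
  move=> /polar_decomp[t [u [t0 uS ->]]].
  have pos v : unit_sphere R n v -> 0 < dotp z v -> dotp y v * dotp z v <= 1.
    move=> vS zv; have [yv|yv] := leP (dotp y v) 0; first by nra.
    have := yK v vS; rewrite inve_pge ?inE/= ?support_fun_ge0 ?lee_fin ?(ltW yv)//.
    rewrite inver gt_eqF// => hv.
    have : ((dotp z v)%:E <= support_fun K v)%E.
      by apply: ereal_sup_ubound; exists z.
    move=> /le_trans/(_ hv); rewrite lee_fin -[leRHS]mul1r ler_pdivlMr//.
    by rewrite mulrC.
  have : dotp y u * dotp z u <= 1.
    have [zu|zu|->] := ltgtP (dotp z u) 0; last by rewrite mulr0.
      have := pos (- u); rewrite !dotpNr mulrNN; apply; last by lra.
      by rewrite /unit_sphere/= !dotp_lin opprK.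
    exact: pos.
  move: (uS); rewrite /unit_sphere/= !dotp_lin => ->; nra.
- have [yu|yu] := leP (dotp y u) 0.
    by apply: (@le_trans _ _ 0%E); rewrite ?lee_fin// inve_ge0 support_fun_ge0.
  rewrite inve_pge ?inE/= ?support_fun_ge0 ?lee_fin ?(ltW yu)//.
  rewrite inver gt_eqF//; apply: ge_ereal_sup => _ [z Kz <-].
  rewrite lee_fin -[leRHS]mul1r ler_pdivlMr// mulrC.
  by have := yK z Kz u; rewrite uS.
Qed.

Lemma subset_bireciprocal (R : realType) (n : nat) (K : set 'rV[R]_n) :
  convex_body R n K -> K `<=` reciprocal (reciprocal K).
Proof.
move=> hK; have [_ _ K0] := hK.
have [_ _ K'0] := reciprocal_convex_body hK.
move=> y Ky; apply/reciprocalP => // z /reciprocalP-/(_ K0)/(_ y Ky).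
exact: reciprocal_relC.
Qed.

(** * Membership in the flower *)

(** The factor [c] makes up for the supremum [h_K] not being attained: for [x = t u]
    the right side says that [c t <= <y, u>] for some [y] in [K]. *)
Lemma in_flowerP (R : realType) (n : nat) (K : set 'rV[R]_n) (x : 'rV[R]_n) :
  K 0 -> flower K x <->
    forall c, 0 < c < 1 -> exists2 y, K y & c * dotp x x <= dotp x y.
Proof.
move=> K0; have [sF rF] := (flowerP K0 _).1 erefl.
have [->|] := eqVneq x 0.
  split=> _; last exact: star_set0 sF.1.
  by move=> c _; exists 0; rewrite // !dotp0l mulr0.
move=> /polar_decomp[t [u [t0 uS ->]]].
have uu : dotp u u = 1 by [].
apply: (iff_trans (star_bodyE sF uS (ltW t0))); rewrite rF//; split.
  move=> th c /andP[c0 c1].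
  have : ((c * t)%:E < support_fun K u)%E.
    by apply: lt_le_trans th; rewrite lte_fin; nra.
  move=> /ereal_sup_gt[_ [y Ky <-]]; rewrite lte_fin => cy.
  by exists y => //; rewrite !dotp_lin uu (dotpC u); nra.
move=> ct; rewrite leNgt; apply/negP => ht.
have := support_fun_ge0 u K0.
case E : (support_fun K u) ht => [r| |]//; rewrite lte_fin lee_fin => rt r0.
(* [c t] is the midpoint of [r] and [t], above every value of [<., u>] on [K]. *)
have t2 : 0 < 2 * t by lra.
have c01 : 0 < (r + t) / (2 * t) < 1.
  by rewrite divr_gt0 ?ltr_pdivrMr//=; lra.
have [y Ky] := ct _ c01.
rewrite !dotp_lin uu mulr1 (dotpC u) mulrCA ler_pM2l//.
rewrite (_ : (r + t) / (2 * t) * t = (r + t) / 2); last by field; rewrite gt_eqF.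
have : ((dotp y u)%:E <= r%:E)%E.
  by rewrite -E; apply: ereal_sup_ubound; exists y.
by rewrite lee_fin; lra.
Qed.

(** Plain real weights, in place of weights packaged with their bounds, can be
    produced and compared by arithmetic. *)
Lemma convex_setP (R : realType) (n : nat) (A : set 'rV[R]_n) :
  convex_set A <-> forall x y l, A x -> A y -> 0 <= l -> l <= 1 ->
    A (l *: x + (1 - l) *: y).
Proof.
split=> [cA x y l Ax Ay l0 l1|cA x y l].
  have l01 : Itv.spec (@Itv.num_sem R) (Itv.Real `[0%Z, 1%Z]) l.
    by rewrite /= /Itv.num_sem/= num_real /= in_itv/= l0 l1.
  by have := cA x y (Itv.mk l01) (mem_set Ax) (mem_set Ay); rewrite inE.
by rewrite !inE => Ax Ay; apply: cA.
Qed.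

(** * Flowers of reciprocal bodies *)

(** The condition on [x] says that [x] lies in the ball with centre [y / 2] and
    radius [|y| / 2]. *)
Lemma flower_ball (R : realType) (n : nat) (x y : 'rV[R]_n) :
  dotp x x <= dotp x y -> enorm (2 *: x - y) <= enorm y.
Proof.
move=> xy; rewrite enorm_le ?enorm_ge0// sqr_enorm !dotp_lin (dotpC y x); lra.
Qed.

(** The point [y = Y + s e] is equidistant from the origin and from [Y + e], so
    the midpoint [m] of these two is the foot of the perpendicular from [y] to
    their line, and [<m, y> = |m|^2]. Such a [y] is where the segment from [Y] to
    [Y + e] meets the bisector hyperplane of the origin and [Y + e], which makes
    the equation for [s] linear. *)
Lemma refocus (R : realType) (n : nat) (Y e : 'rV[R]_n) :
  enorm Y < enorm e -> exists s, [/\ 0 <= s, s <= 1,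
    enorm (Y + s *: e) = (1 - s) * enorm e &
    dotp (Y + e) (Y + s *: e) * 2 = dotp (Y + e) (Y + e)].
Proof.
move=> Ye; have Y0 := enorm_ge0 Y.
have en0 : 0 < enorm e by exact: le_lt_trans Ye.
have D0 : 0 < dotp e e + dotp Y e.
  have := dotp_le_enorm (- Y) e.
  have -> : enorm (- Y) = enorm Y by rewrite /enorm !dotp_lin opprK.
  rewrite !dotp_lin -sqr_enorm; nra.
have Ye2 : dotp Y Y < dotp e e by rewrite -!sqr_enorm; nra.
pose s := (dotp e e - dotp Y Y) / (2 * (dotp e e + dotp Y e)).
have sE : 2 * s * (dotp e e + dotp Y e) = dotp e e - dotp Y Y.
  by rewrite /s; field; rewrite gt_eqF.
have s0 : 0 <= s by rewrite divr_ge0//; lra.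
have s1 : s <= 1.
  rewrite ler_pdivrMr; last by lra.
  by have := dotp_ge0 (Y + e); rewrite !dotp_lin (dotpC e Y); lra.
exists s; split=> //.
- have e0 : 0 <= (1 - s) * enorm e by rewrite mulr_ge0 ?subr_ge0// ltW.
  apply/eqP; rewrite -(eqrXn2 (n := 2)) ?enorm_ge0// exprMn !sqr_enorm.
  by apply/eqP; rewrite !dotp_lin (dotpC e Y); lra.
- by rewrite !dotp_lin (dotpC e Y); lra.
Qed.

(** The combination [Y] satisfies [<Y, z> + rho |z| <= 2] with
    [rho = l |y1| + (1 - l) |y2|], which is more than membership in the reciprocal
    when [|Y| < rho]; this slack is what moving along [e] uses up. *)
Lemma convex_flower_reciprocal (R : realType) (n : nat) (T : set 'rV[R]_n) :
  convex_body R n T -> convex_set (flower (reciprocal T)).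
Proof.
move=> hT; have [_ _ T0] := hT.
have [_ /convex_setP cK K0] := reciprocal_convex_body hT.
apply/convex_setP => x1 x2 l Fx1 Fx2 l0 l1; apply/in_flowerP => // c c01.
have /andP[c0 c1] := c01.
have [y1 Ky1 xy1] := (in_flowerP _ K0).1 Fx1 c c01.
have [y2 Ky2 xy2] := (in_flowerP _ K0).1 Fx2 c c01.
pose Y := l *: y1 + (1 - l) *: y2.
set m := l *: x1 + _; pose e := 2 *: (c *: m) - Y.
have scaled x y : c * dotp x x <= dotp x y ->
    dotp (c *: x) (c *: x) <= dotp (c *: x) y.
  by rewrite !dotp_lin; nra.
have ee : enorm e <= l * enorm y1 + (1 - l) * enorm y2.
  have -> : e = l *: (2 *: (c *: x1) - y1) + (1 - l) *: (2 *: (c *: x2) - y2).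
    by rewrite /e /m /Y; apply/rowP => i; rewrite !mxE; ring.
  apply: le_trans (ler_enormD _ _) _; rewrite !enormZ ?subr_ge0//.
  by rewrite lerD// ler_wpM2l ?subr_ge0// flower_ball// scaled.
have YeE : Y + e = 2 *: (c *: m) by rewrite /e addrC subrK.
have KY : reciprocal T Y by exact: cK.
have YzE z : dotp Y z = l * dotp y1 z + (1 - l) * dotp y2 z by rewrite !dotp_lin.
clearbody e Y.
suff [y Ky] : exists2 y, reciprocal T y &
    dotp (Y + e) (Y + e) <= dotp (Y + e) y * 2.
  move=> h; exists y => //; move: h; rewrite YeE !dotp_lin; nra.
have [eY|Ye] := leP (enorm e) (enorm Y).
  exists Y => //.
  move: eY; rewrite enorm_le ?enorm_ge0// sqr_enorm.
  by rewrite !dotp_lin (dotpC e Y); lra.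
have [s [s0 s1 ys yY]] := refocus Ye.
exists (Y + s *: e); last by rewrite yY.
apply/reciprocalP => // z Tz; apply/reciprocal_rel_paraboloid.
have rel1 := (reciprocal_rel_paraboloid _ _).1 ((reciprocalP _ T0).1 Ky1 z Tz).
have rel2 := (reciprocal_rel_paraboloid _ _).1 ((reciprocalP _ T0).1 Ky2 z Tz).
have -> : dotp (Y + s *: e) z =
    l * dotp y1 z + (1 - l) * dotp y2 z + s * dotp e z.
  by rewrite !dotp_lin YzE.
rewrite ys; have ez := dotp_le_enorm e z; have zn := enorm_ge0 z.
have := ler_wpM2l s0 ez; have := ler_wpM2r zn ee.
have := ler_wpM2l l0 rel1; have := ler_wpM2l (_ : 0 <= 1 - l) rel2.
rewrite subr_ge0 => /(_ l1); lra.
Qed.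

(** * Separation *)

Lemma dotp_continuousl (R : realType) (n : nat) (v : 'rV[R]_n) :
  continuous (fun x : 'rV[R]_n => dotp x v).
Proof.
move=> x; apply: continuous_big => [|i _ y]; first exact: add_continuous.
apply: (@cvgM _ _ (nbhs y)); last exact: cvg_cst.
exact: (@coord_continuous _ _ _ 0 i y).
Qed.

Lemma dotp_continuous_diag (R : realType) (n : nat) :
  continuous (fun x : 'rV[R]_n => dotp x x).
Proof.
move=> x; apply: continuous_big => [|i _ y]; first exact: add_continuous.
by apply: (@cvgM _ _ (nbhs y)); exact: (@coord_continuous _ _ _ 0 i y).
Qed.

Lemma affine_continuous (R : realType) (n : nat) (a : R) (v : 'rV[R]_n) :
  continuous (fun u : 'rV[R]_n => a *: u + v).
Proof.
by move=> u; apply: continuousD; [exact: scaler_continuous|exact: cst_continuous].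
Qed.

(** The norm of the ambient space is the maximum of the coordinates; [1 + r]
    bounds it because [a^2 <= r] implies [|a| <= 1 + r]. *)
Lemma bounded_dotp (R : realType) (n : nat) (A : set 'rV[R]_n) (r : R) :
  (forall x, A x -> dotp x x <= r) -> bounded_set A.
Proof.
move=> Ar; exists (1 + r); split; first exact: num_real.
move=> M rM x /Ar xr; rewrite /Num.norm/= mx_normrE.
have xM i : `|x 0 i| <= M.
  have : x 0 i * x 0 i <= dotp x x.
    rewrite /dotp (bigD1 i)//= lerDl sumr_ge0// => j _.
    by rewrite -expr2 sqr_ge0.
  have := dotp_ge0 x; rewrite ler_norml; nra.
apply/bigmax_leP; split => [|[i j] _ /=]; last by rewrite (ord1 i).
have := dotp_ge0 x; lra.
Qed.

(** Only points at least as close to [p] as a given one matter, and these form a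
    compact set. *)
Lemma closed_nearest (R : realType) (n : nat) (D : set 'rV[R]_n) (p : 'rV[R]_n) :
  closed D -> D !=set0 -> exists2 q, D q &
    forall x, D x -> dotp (p - q) (p - q) <= dotp (p - x) (p - x).
Proof.
move=> cD [a Da].
have cf : continuous (fun x : 'rV[R]_n => dotp (p - x) (p - x)).
  move=> x; apply: (@continuous_comp _ _ _ (fun x : 'rV[R]_n => p - x)
      (fun x : 'rV[R]_n => dotp x x)); last exact: dotp_continuous_diag.
  exact: (@cvgB _ _ _ (nbhs x) _ (fun=> p) id p x (cvg_cst p) cvg_id).
pose A := D `&` [set x | dotp (p - x) (p - x) <= dotp (p - a) (p - a)].
have cA : closed A.
  apply: closedI => //.
  apply: (@preimage_closed _ _ (fun x : 'rV[R]_n => dotp (p - x) (p - x))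
    [set r : R | r <= dotp (p - a) (p - a)]); last exact: closed_le.
  by move=> x _; exact: cf.
have bA : bounded_set A.
  apply: (@bounded_dotp _ _ _ (2 * dotp (p - a) (p - a) + 2 * dotp p p)) => x [_ /=].
  have := dotp_ge0 (2 *: p - x); rewrite !dotp_lin (dotpC x p); nra.
have A0 : A !=set0 by exists a; split=> //=.
have [q /set_mem[Dq qa] qmin] := EVT_min_rV A0 (bounded_closed_compact bA cA)
  (continuous_subspaceT cf).
exists q => // x Dx.
have [xa|ax] := leP (dotp (p - x) (p - x)) (dotp (p - a) (p - a)).
  by apply: qmin; apply/mem_set; split.
exact: le_trans qa (ltW ax).
Qed.

(** The vector [w] from the nearest point [q] of [D] to [p] makes no acute angle
    with [D]: otherwise a small step from [q] into [D] would come closer to [p].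
    Since [0] is in [D], the level [<q, w>] is nonnegative, so the midpoint of
    [<q, w>] and [<p, w>] is positive and can be scaled to [1]. *)
Lemma polar_separation (R : realType) (n : nat) (D : set 'rV[R]_n) (p : 'rV[R]_n) :
  convex_body R n D -> ~ D p ->
  exists z, (forall x, D x -> dotp x z <= 1) /\ 1 < dotp p z.
Proof.
move=> [cD /convex_setP vD D0] nDp.
have [q Dq qmin] := closed_nearest p cD (ex_intro _ 0 D0).
pose w := p - q.
have ww : 0 < dotp w w.
  apply: dotp_gt0; apply/eqP => /eqP; rewrite subr_eq0 => /eqP pq.
  by apply: nDp; rewrite pq.
have obtuse x : D x -> dotp x w <= dotp q w.
  move=> Dx; rewrite leNgt; apply/negP => qx.
  pose d := dotp x w - dotp q w; have d0 : 0 < d by rewrite subr_gt0.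
  pose N := dotp (x - q) (x - q).
  have N0 : 0 <= N by exact: dotp_ge0.
  have dN : 0 < d + N by lra.
  pose l := d / (d + N).
  have l0 : 0 < l by rewrite divr_gt0.
  have l1 : l <= 1 by rewrite ler_pdivrMr//; lra.
  have := qmin _ (vD x q l Dx Dq (ltW l0) l1).
  have -> : p - (l *: x + (1 - l) *: q) = w - l *: (x - q).
    by rewrite /w; apply/rowP => i; rewrite !mxE; ring.
  rewrite -/w; have -> : dotp (w - l *: (x - q)) (w - l *: (x - q)) =
      dotp w w - l * (2 * d - l * N).
    rewrite /N /d; move: (w) => v; rewrite !dotp_lin.
    by rewrite (dotpC x v) (dotpC q v) (dotpC q x); ring.
  rewrite lerBrDr gerDl pmulr_rle0// subr_le0.
  have -> : l * N = d - l * d by rewrite /l; field; rewrite gt_eqF.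
  have := mulr_gt0 l0 d0; lra.
have b0 := obtuse 0 D0; rewrite dotp0l in b0.
have pw : dotp p w = dotp q w + dotp w w by rewrite /w dotpDl dotpNl; ring.
have a0 : 0 < dotp q w + dotp p w by lra.
exists ((2 / (dotp q w + dotp p w)) *: w); split=> [x /obtuse xw|].
  by rewrite dotpZr mulrAC ler_pdivrMr//; lra.
by rewrite dotpZr mulrAC ltr_pdivlMr//; lra.
Qed.

(** * Bodies with a convex flower *)

Lemma in_flower (R : realType) (n : nat) (K : set 'rV[R]_n) (x y : 'rV[R]_n) :
  K 0 -> K y -> dotp x x <= dotp x y -> flower K x.
Proof.
move=> K0 Ky xy; apply/in_flowerP => // c /andP[c0 c1].
by exists y => //; have := dotp_ge0 x; nra.
Qed.

(** The orthogonal projection of [w] on the line of [x] lies on the sphere with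
    diameter [[0, w]], hence in the flower; its product with [z] is
    [<w, x> <z, x> / |x|^2]. *)
Lemma polar_flower_sub_reciprocal (R : realType) (n : nat) (K : set 'rV[R]_n)
    (z : 'rV[R]_n) :
  K 0 -> (forall x, flower K x -> dotp x z <= 1) -> reciprocal K z.
Proof.
move=> K0 zF; apply/reciprocalP => // w Kw x.
have [->|/dotp_gt0 xx] := eqVneq x 0; first by rewrite dotpC dotp0l mul0r dotp0l.
have /zF : flower K ((dotp w x / dotp x x) *: x).
  apply: (in_flower K0 Kw); rewrite !dotp_lin (dotpC x w).
  by rewrite le_eqVlt; apply/orP; left; apply/eqP; field; rewrite gt_eqF.
by rewrite dotpZl mulrAC ler_pdivrMr// mul1r mulrC (dotpC x z).
Qed.

(** Combinations are continuous in each argument separately, so the closure is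
    reached one argument at a time. *)
Lemma closure_convex (R : realType) (n : nat) (A : set 'rV[R]_n) :
  convex_set A -> convex_set (closure A).
Proof.
move=> /convex_setP cA; apply/convex_setP => x y l Ax Ay l0 l1.
have extend (f : 'rV[R]_n -> 'rV[R]_n) : continuous f ->
    (forall a, A a -> closure A (f a)) -> forall a, closure A a -> closure A (f a).
  move=> cf fA; have cP : closed (f @^-1` closure A).
    by apply: preimage_closed; [move=> u _; exact: cf|exact: closed_closure].
  by move=> a /(closureS fA); rewrite -((closure_id _).1 cP).
apply: (extend (fun u => l *: u + (1 - l) *: y)) => [|a Aa|//].
  exact: affine_continuous.
rewrite addrC; apply: (extend (fun u => (1 - l) *: u + l *: a)) => [|b Ab|//].
  exact: affine_continuous.
by apply: subset_closure; rewrite addrC; exact: cA.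
Qed.

(** A point of the closure seen from an interior point [q]: if [p + e (p - q)] were
    a limit of points [c] of [C], then [p] would be a combination of such a [c]
    and of a point of [C] near [q]. *)
Lemma notin_closure_away (R : realType) (n : nat) (C U : set 'rV[R]_n)
    (p q : 'rV[R]_n) (e : R) :
  convex_set C -> open U -> U `<=` C -> U q -> ~ C p -> 0 < e ->
  ~ closure C (p + e *: (p - q)).
Proof.
move=> /convex_setP cC oU UC Uq nCp e0 clC; apply: nCp.
set p' := p + _ in clC.
(* [f c] is the point for which [(1 + e) p = c + e (f c)]. *)
pose f (c : 'rV[R]_n) := (- e^-1) *: c + e^-1 *: ((1 + e) *: p).
have fp' : f p' = q.
  by rewrite /f /p'; apply/rowP => i; rewrite !mxE; field; rewrite gt_eqF.
have cf : continuous f by exact: affine_continuous.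
have /clC[c [Cc Ufc]] : nbhs p' (f @^-1` U).
  by apply: cf; rewrite fp'; exact: open_nbhs_nbhs.
have -> : p = (1 + e)^-1 *: c + (1 - (1 + e)^-1) *: f c.
  by rewrite /f; apply/rowP => i; rewrite !mxE; field; rewrite !gt_eqF//; lra.
apply: cC => //; [exact: UC|rewrite invr_ge0; lra|].
by rewrite invf_le1; lra.
Qed.

Lemma small_step (R : realType) (a b c : R) :
  0 < a -> exists2 e, 0 < e & 0 < a + e * b + e ^+ 2 * c.
Proof.
move=> a0; pose s := a + `|b| + `|c|.
have b0 := normr_ge0 b; have c0 := normr_ge0 c.
have s0 : 0 < s by rewrite /s; lra.
pose e := a / s; have e0 : 0 < e by rewrite divr_gt0.
have es : e * s = a by rewrite /e; field; rewrite gt_eqF.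
exists e => //.
have e1 : e <= 1 by rewrite ler_pdivrMr// /s; lra.
have hb : - (e * `|b|) <= e * b.
  by rewrite -mulrN ler_wpM2l ?(ltW e0)// lerNl ler_normr lexx orbT.
have hc : - (e * `|c|) <= e ^+ 2 * c.
  apply: (@le_trans _ _ (- (e ^+ 2 * `|c|))).
    by rewrite lerN2 ler_wpM2r// expr2 ger_pMr.
  by rewrite -mulrN ler_wpM2l ?sqr_ge0// lerNl ler_normr lexx orbT.
have := mulr_gt0 e0 a0; rewrite /s in es; lra.
Qed.

(** If [K] has a nonzero point [y0], its ball gives the flower an interior; the
    strict inequality [|p|^2 < <y, p>] survives a small step from [p] away from the
    centre of that ball. If [K] is just the origin, so is its flower, and [z] can be
    chosen along [p]. *)
Lemma flower_separation (R : realType) (n : nat) (K : set 'rV[R]_n)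
    (p y : 'rV[R]_n) :
  K 0 -> convex_set (flower K) -> ~ flower K p -> dotp p p < dotp y p ->
  exists2 z, reciprocal K z & ~ reciprocal_rel y z.
Proof.
move=> K0 cF nFp py.
suff [z [x [zF zx yx]]] : exists z x, [/\ forall v, flower K v -> dotp v z <= 1,
    1 < dotp x z & dotp x x < dotp y x].
  exists z; first exact: polar_flower_sub_reciprocal.
  move=> /(_ x); rewrite (dotpC z x); apply/negP; rewrite -ltNge.
  have yx0 : 0 < dotp y x by apply: le_lt_trans yx; exact: dotp_ge0.
  by apply: lt_trans yx _; rewrite ltr_pMr.
have F0 : flower K 0 by apply: (in_flower K0 K0); rewrite !dotp0l.
have p0 : p != 0 by apply/eqP => pE; apply: nFp; rewrite pE.
have [[y0 Ky0 y0N]|K_triv] := pselect (exists2 y0, K y0 & y0 != 0); last first.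
  exists ((2 / dotp p p) *: p), p; split=> //.
    move=> v /(in_flowerP _ K0)/(_ (1 / 2)) h.
    have [|w Kw] := h; first by lra.
    have -> : w = 0.
      by apply/eqP/negPn/negP => w0; apply: K_triv; exists w.
    rewrite (dotpC v 0) dotp0l.
    have [->|/dotp_gt0 vv] := eqVneq v 0; first by rewrite !dotp0l ler01.
    lra.
  by rewrite dotpZr divfK ?gt_eqF ?dotp_gt0//; lra.
pose q := 2^-1 *: y0.
pose U := [set x : 'rV[R]_n | 0 < dotp x y0 - dotp x x].
have oU : open U.
  apply: (@open_comp _ _ (fun x : 'rV[R]_n => dotp x y0 - dotp x x)
    [set r : R | 0 < r]); last exact: open_gt.
  move=> x _; exact: (@cvgB _ _ _ (nbhs x) _ (fun x => dotp x y0) (fun x => dotp x x)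
    _ _ (@dotp_continuousl _ _ _ x) (@dotp_continuous_diag _ _ x)).
have UF : U `<=` flower K.
  by move=> x; rewrite /U/= subr_gt0 => /ltW; exact: in_flower.
have Uq : U q by have := dotp_gt0 y0N; rewrite /U /q /= !dotp_lin; lra.
have gap : 0 < dotp y p - dotp p p by rewrite subr_gt0.
(* The quadratic in [e] is [<y, p'> - |p'|^2] for [p' = p + e (p - q)]. *)
have [e e0] := small_step (dotp y (p - q) - 2 * dotp p (p - q))
  (- dotp (p - q) (p - q)) gap.
set d := p - q => ed.
have yx : dotp (p + e *: d) (p + e *: d) < dotp y (p + e *: d).
  by move: ed; clearbody d; rewrite !dotp_lin (dotpC d p); lra.
have nclF := notin_closure_away cF oU UF Uq nFp e0.
have clF : convex_body R n (closure (flower K)).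
  split; [exact: closed_closure|exact: closure_convex|exact: subset_closure].
have [z [zF zx]] := polar_separation clF nclF.
exists z, (p + e *: d); split=> // v Fv; exact/zF/subset_closure.
Qed.

(** If [<x, z> <= 1 < <y, z>] for all [x] in [K], then [p] can be the multiple
    [s z] for which [<p, z>] lies halfway between [1] and [<y, z>]. *)
Lemma flower_separation_point (R : realType) (n : nat) (K : set 'rV[R]_n)
    (y : 'rV[R]_n) :
  convex_body R n K -> ~ K y -> exists2 p, ~ flower K p & dotp p p < dotp y p.
Proof.
move=> hK nKy; have [_ _ K0] := hK.
have [z [zK yz]] := polar_separation hK nKy.
have zz : 0 < dotp z z.
  apply: dotp_gt0; apply/eqP => z0; move: yz; rewrite z0 dotpC dotp0l; lra.
pose s := (1 + dotp y z) / (2 * dotp z z).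
have sz : 2 * (s * dotp z z) = 1 + dotp y z by rewrite /s; field; rewrite gt_eqF.
have s0 : 0 < s by rewrite divr_gt0//; lra.
exists (s *: z); last by rewrite !dotp_lin; nra.
move=> /(in_flowerP _ K0) Fp.
have sz1 : 1 < s * dotp z z by lra.
(* With this [c], the bound [c s |z|^2 <= <x, z>] exceeds [1]. *)
pose c := (1 + (s * dotp z z)^-1) / 2.
have ci : (s * dotp z z)^-1 < 1 by rewrite invf_lt1//; lra.
have ci0 : 0 < (s * dotp z z)^-1 by rewrite invr_gt0; lra.
have [|x Kx] := Fp c; first by rewrite /c; lra.
rewrite !dotp_lin mulrCA ler_pM2l// (dotpC z x); have := zK x Kx.
have : c * (s * dotp z z) = (1 + s * dotp z z) / 2.
  by rewrite /c; field; rewrite !gt_eqF.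
lra.
Qed.

Lemma bireciprocal_sub (R : realType) (n : nat) (K : set 'rV[R]_n) :
  convex_body R n K -> convex_set (flower K) -> reciprocal (reciprocal K) `<=` K.
Proof.
move=> hK cF y; have [_ _ K0] := hK.
have [_ _ K'0] := reciprocal_convex_body hK.
move=> /reciprocalP-/(_ K'0) yK''; apply: contrapT => nKy.
have [p nFp py] := flower_separation_point hK nKy.
have [z zK' yz] := flower_separation K0 cF nFp py.
exact/yz/yK''.
Qed.

Theorem theorem9 (R : realType) (n : nat) (K : set 'rV[R]_n)
    (hK : convex_body R n K) :
  reciprocal_bodies R n K <-> convex_set (flower K).
Proof.
split=> [[T hT <-]|cF]; first exact: convex_flower_reciprocal.
exists (reciprocal K); first exact: reciprocal_convex_body.
by apply/seteqP; split; [exact: bireciprocal_sub|exact: subset_bireciprocal].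
Qed.
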